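(* Let $N\ge 0$ be an integer and let the $q$-hypergeometric Euler numbers $\mathcal E_{N,k}$ be defined by $\sum_{k=0}^\infty\mathcal E_{N,k}\frac{x^k}{k!}=\left(\sum_{n=0}^\infty\frac{[2N]_q!\,x^{2n}}{[2N+2n]_q!}\right)^{-1}$. Then, as formal power series in $x$, $$\sum_{k=0}^\infty\mathcal E_{N,k}\frac{x^k}{k!}=1-\cfrac{x^2}{[2N+1]_q[2N+2]_q+x^2-\cfrac{[2N+1]_q[2N+2]_q x^2}{[2N+3]_q[2N+4]_q+x^2-\cfrac{[2N+3]_q[2N+4]_q x^2}{[2N+5]_q[2N+6]_q+x^2-\ddots}}}.$$
   Context: $q\ne 1$ is a complex number that is not a root of unity; $[n]_q=\frac{1-q^n}{1-q}$, $[n]_q!=[n]_q[n-1]_q\cdots[1]_q$ for $n\ge1$, and $[0]_q!=1$. The infinite continued fraction is the limit, in the $x$-adic topology on formal power series, of its finite truncations (the $j$-th one ending with the partial denominator $[2N+2j-1]_q[2N+2j]_q+x^2$), each truncation being a rational function of $x$ expanded as a formal power series at $x=0$. *)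

(* Defs.v *)
From HB Require Import structures.
From mathcomp Require Import all_boot all_order all_algebra.
From mathcomp Require Import boolp reals.
From mathcomp Require Export complex.

Set Implicit Arguments.
Unset Strict Implicit.
Unset Printing Implicit Defensive.

Import GRing.Theory.
Local Open Scope ring_scope.

Local Notation "p %:F" := (tofrac p).

(** Formal power series, as a record so that they do not inherit the pointwise
    ring structure of [nat -> K]. *)
Record fps (K : Type) := Fps { fcoef :> nat -> K }.

HB.instance Definition _ (K : choiceType) := [isNew for @fcoef K].
HB.instance Definition _ (K : choiceType) := [Choice of fps K by <:].

Section FpsRing.
Variable K : fieldType.
Implicit Types f g h : fps K.

Lemma fpsP f g : (forall n, f n = g n) <-> f = g.
Proof.
split=> [fg|-> //]; case: f g fg => [f] [g] /= fg.
by congr Fps; apply/funext.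
Qed.

Definition fps_zero : fps K := Fps (fun=> 0).
Definition fps_one : fps K := Fps (fun n => (n == 0%N)%:R).
Definition fps_opp f : fps K := Fps (fun n => - f n).
Definition fps_add f g : fps K := Fps (fun n => f n + g n).
Definition fps_mul f g : fps K :=
  Fps (fun n => \sum_(i < n.+1) f i * g (n - i)%N).

Fact fps_addA : associative fps_add.
Proof. by move=> f g h; apply/fpsP => n /=; rewrite addrA. Qed.
Fact fps_addC : commutative fps_add.
Proof. by move=> f g; apply/fpsP => n /=; rewrite addrC. Qed.
Fact fps_add0 : left_id fps_zero fps_add.
Proof. by move=> f; apply/fpsP => n /=; rewrite add0r. Qed.
Fact fps_addN : left_inverse fps_zero fps_opp fps_add.
Proof. by move=> f; apply/fpsP => n /=; rewrite addNr. Qed.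

HB.instance Definition _ :=
  GRing.isZmodule.Build (fps K) fps_addA fps_addC fps_add0 fps_addN.

Definition fps_trunc n f : {poly K} := \poly_(i < n) f i.

Lemma coef_fps_trunc n f i : (i < n)%N -> (fps_trunc n f)`_i = f i.
Proof. by move=> lt_in; rewrite coef_poly lt_in. Qed.

Lemma fps_mul_trunc m n f g : (n < m)%N ->
  fps_mul f g n = (fps_trunc m f * fps_trunc m g)`_n.
Proof.
move=> lt_nm; rewrite coefM; apply: eq_bigr => -[i /= lt_in] _.
by rewrite !coef_fps_trunc // (leq_ltn_trans _ lt_nm) // ?leq_subr.
Qed.

Fact fps_mulC : commutative fps_mul.
Proof.
by move=> f g; apply/fpsP => n; rewrite !(@fps_mul_trunc n.+1) // mulrC.
Qed.

Lemma fps_mul_truncl m n f (p : {poly K}) g :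
  (n < m)%N -> (forall i, (i < m)%N -> f i = p`_i) ->
  fps_mul f g n = (p * fps_trunc m g)`_n.
Proof.
move=> lt_nm fp; rewrite coefM; apply: eq_bigr => -[i /= lt_in] _.
rewrite coef_fps_trunc ?(leq_ltn_trans _ lt_nm) ?leq_subr // fp //.
exact: leq_ltn_trans lt_nm.
Qed.

Fact fps_mulA : associative fps_mul.
Proof.
move=> f g h; apply/fpsP => n; rewrite fps_mulC.
rewrite (@fps_mul_truncl n.+1 _ _ (fps_trunc n.+1 g * fps_trunc n.+1 h)) //.
  rewrite (@fps_mul_truncl n.+1 _ _ (fps_trunc n.+1 f * fps_trunc n.+1 g)) //.
    by rewrite mulrC mulrA.
  by move=> i lti; rewrite (fps_mul_trunc _ _ lti).
by move=> i lti; rewrite (fps_mul_trunc _ _ lti).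
Qed.

Fact fps_mul1 : left_id fps_one fps_mul.
Proof.
move=> f; apply/fpsP => n /=; rewrite big_ord_recl /= mul1r subn0 big1 ?addr0 //.
by move=> i _; rewrite mul0r.
Qed.

Fact fps_mulDl : left_distributive fps_mul fps_add.
Proof.
move=> f g h; apply/fpsP => n /=; rewrite -big_split /=.
by apply: eq_bigr => i _; rewrite mulrDl.
Qed.

Fact fps_one_neq0 : fps_one != 0.
Proof.
by apply/eqP => /fpsP /(_ 0%N) /= /eqP; rewrite oner_eq0.
Qed.

HB.instance Definition _ := GRing.Zmodule_isComNzRing.Build (fps K)
  fps_mulA fps_mulC fps_mul1 fps_mulDl fps_one_neq0.

(** [fps_inv_seq f n] lists the coefficients 0, ..., n of the inverse. *)
Fixpoint fps_inv_seq f n : seq K :=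
  if n is n'.+1 then
    let s := fps_inv_seq f n' in
    rcons s (- (f 0%N)^-1 * \sum_(i < n'.+1) f i.+1 * s`_(n' - i)%N)
  else [:: (f 0%N)^-1].

Definition fps_unit : pred (fps K) := fun f => f 0%N != 0.
Definition fps_inv f : fps K :=
  if fps_unit f then Fps (fun n => (fps_inv_seq f n)`_n) else f.

Lemma size_fps_inv_seq f n : size (fps_inv_seq f n) = n.+1.
Proof. by elim: n => //= n IHn; rewrite size_rcons IHn. Qed.

Lemma nth_fps_inv_seq f n i :
  (i <= n)%N -> (fps_inv_seq f n)`_i = (fps_inv_seq f i)`_i.
Proof.
elim: n => [|n IHn]; first by rewrite leqn0 => /eqP->.
rewrite leq_eqVlt => /predU1P[-> //|lt_in].
by rewrite [in LHS]/= nth_rcons size_fps_inv_seq lt_in IHn.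
Qed.

Fact fps_mulVf : {in fps_unit, left_inverse 1 fps_inv *%R}.
Proof.
move=> f f_unit; rewrite mulrC; apply/fpsP => n.
have f0 : f 0%N != 0 by [].
rewrite /fps_inv [fps_unit f]f_unit /GRing.mul /=.
case: n => [|n]; first by rewrite big_ord1 /= divff.
rewrite big_ord_recl subn0 /= nth_rcons size_fps_inv_seq ltnn eqxx.
rewrite mulrA mulrN divff // mulN1r addrC; apply/eqP; rewrite subr_eq0.
by apply/eqP/eq_bigr => i _; rewrite subSS (nth_fps_inv_seq _ (leq_subr _ _)).
Qed.

Fact fps_unitPl f g : g * f = 1 -> fps_unit f.
Proof.
move=> /fpsP /(_ 0%N); rewrite /GRing.mul /= big_ord1 /= => gf.
by apply: contra_eq_neq gf => ->; rewrite mulr0 eq_sym oner_neq0.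
Qed.

Fact fps_inv_out : {in [predC fps_unit], fps_inv =1 id}.
Proof. by move=> f /negbTE nuf; rewrite /fps_inv ifF. Qed.

HB.instance Definition _ := GRing.ComNzRing_hasMulInverse.Build (fps K)
  fps_mulVf fps_unitPl fps_inv_out.

Lemma fps_unitE f : (f \is a GRing.unit) = (f 0%N != 0).
Proof. by []. Qed.

Definition egf (a : nat -> K) : fps K := Fps (fun k => a k / k`!%:R).

(** Convergence for the x-adic topology: u_j - s is eventually divisible by
    any given power x^n. *)
Definition xadic_cvg (u : nat -> fps K) (s : fps K) : Prop :=
  forall n, exists J, forall j, (J <= j)%N -> forall i, (i < n)%N -> u j i = s i.

Definition fps_of_poly (p : {poly K}) : fps K := Fps (fun n => p`_n).

Lemma fps_of_polyM p r : fps_of_poly (p * r) = fps_of_poly p * fps_of_poly r.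
Proof. by apply/fpsP => n; rewrite /= coefM. Qed.

(** [r] is regular at 0 with power series expansion [s]. *)
Definition is_expansion (r : {fraction {poly K}}) (s : fps K) : Prop :=
  exists a b : {poly K}, [/\ b`_0 != 0, r = a%:F / b%:F &
    s = fps_of_poly a / fps_of_poly b].

Lemma is_expansion_uniq r s t : is_expansion r s -> is_expansion r t -> s = t.
Proof.
move=> [a [b [b0 -> ->]]] [c [d [d0 + ->]]].
have pn0 (p : {poly K}) : p`_0 != 0 -> p%:F != 0.
  by move=> p0; rewrite tofrac_eq0; apply: contraNneq p0 => ->; rewrite coef0.
move=> /eqP; rewrite eqr_div ?pn0 // -!rmorphM /= tofrac_eq => /eqP adcb.
have unit_of (p : {poly K}) : p`_0 != 0 -> fps_of_poly p \is a GRing.unit.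
  by [].
apply: (mulIr (unit_of _ b0)); apply: (mulIr (unit_of _ d0)).
rewrite (mulrVK (unit_of _ b0)) [RHS]mulrAC (mulrVK (unit_of _ d0)).
by rewrite -!fps_of_polyM adcb.
Qed.

(** The finite continued fraction with [j] levels
      a_k / (b_k - a_(k+1) / (b_(k+1) - ... - a_(k+j-1) / b_(k+j-1))). *)
Fixpoint cfrac_tail (F : fieldType) (a b : nat -> F) (k j : nat) : F :=
  if j is j'.+1 then a k / (b k - cfrac_tail a b k.+1 j') else 0.

Definition qnat (q : K) (n : nat) : K := (1 - q ^+ n) / (1 - q).

Definition qfact (q : K) (n : nat) : K := \prod_(1 <= i < n.+1) qnat q i.

(** The even power series sum_n [2N]_q! x^(2n) / [2N+2n]_q!. *)
Definition qhyper (q : K) (N : nat) : fps K :=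
  Fps (fun k => if odd k then 0 else qfact q (2 * N)%N / qfact q (2 * N + k)%N).

Definition qEuler (q : K) (N k : nat) : K := k`!%:R * (qhyper q N)^-1 k.

Definition qpair (q : K) (N j : nat) : K :=
  qnat q (2 * N + 2 * j - 1)%N * qnat q (2 * N + 2 * j)%N.

(** Partial numerators x^2, [2N+1]_q [2N+2]_q x^2, ... and partial
    denominators [2N+1]_q [2N+2]_q + x^2, ..., both indexed from 1. *)
Definition qEuler_num (q : K) (N j : nat) : {fraction {poly K}} :=
  ((if j == 1%N then 1 else qpair q N j.-1) *: 'X^2)%:F.
Definition qEuler_den (q : K) (N j : nat) : {fraction {poly K}} :=
  ((qpair q N j)%:P + 'X^2)%:F.

(** The [j]-th truncation, ending with the [j]-th partial denominator. *)
Definition qEuler_cfrac (q : K) (N j : nat) : {fraction {poly K}} :=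
  1 - cfrac_tail (qEuler_num q N) (qEuler_den q N) 1 j.

End FpsRing.

Lemma egf_qEuler (K : fieldType) (q : K) (N : nat) :
  [pchar K] =i pred0 -> egf (qEuler q N) = (qhyper q N)^-1.
Proof.
move=> /pcharf0P K0; apply/fpsP => k.
by rewrite /= mulrC mulKf // K0 -lt0n fact_gt0.
Qed.

Lemma qhyper_unit (K : fieldType) (q : K) (N : nat) :
  (forall n, (0 < n)%N -> ~~ n.-unity_root q) -> qhyper q N \is a GRing.unit.
Proof.
move=> hq; rewrite fps_unitE /= addn0 divff ?oner_neq0 //.
rewrite prodf_seq_neq0; apply/allP => i; rewrite mem_index_iota => /andP[i0 _].
have q1 n : (0 < n)%N -> 1 - q ^+ n != 0.
  by move=> /hq; rewrite unity_rootE subr_eq0 eq_sym.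
by apply: mulf_neq0; rewrite ?invr_eq0 ?q1 // -[q]expr1 q1.
Qed.

(* Main.v *)
Require Import Defs.
From mathcomp Require Import all_boot all_order all_algebra.
From mathcomp Require Import reals complex.
Import GRing.Theory.
Local Open Scope ring_scope.
Local Open Scope complex_scope.

(** Write [p_j] for the product of the (2N+2j-1)-st and (2N+2j)-th q-numbers.
    The coefficient of [x^(2n)] in the q-hypergeometric series is
    [1 / (p_1 ... p_n)], so this series is a sum of products in Euler's sense,
    and Euler's correspondence turns the reciprocal of each partial sum
      [S_j = sum_(n <= j) x^(2n) / (p_1 ... p_n)]
    into a finite continued fraction. The latter is precisely the [j]-th
    truncation, which therefore equals [1 / S_j] exactly ([euler_cfrac]).

    The correspondence rests on the shifted sums
      [S_(k,j) = sum_(n <= j) x^(2n) / (p_k ... p_(k+n-1))],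
    which satisfy [p_k S_(k,j+1) = p_k + x^2 S_(k+1,j)]. By induction on the
    number of levels, what sits at or below the [k]-th partial denominator is
    the quotient [p_k S_(k,j+1) / S_(k+1,j)] ([euler_cfrac_denominator]).

    Since [S_j] has constant term 1 and agrees with the whole series below
    degree [2j+2], the power series [1 / S_j] exists and agrees with the
    reciprocal of the series below the same degree ([fps_inv_agree]). This is
    the x-adic convergence. *)

(** * Euler's continued fraction of a sum of products *)

(** The partial sums enter only through the recurrence that they satisfy, so
    that the correspondence can be applied in the field of rational functions
    to sums that are polynomials. *)
Lemma euler_cfrac_denominator (F : fieldType) (p a b : nat -> F) (y : F)
    (s : nat -> nat -> F) :
  (forall k, (0 < k)%N -> p k != 0) ->
  (forall k j, s k j != 0) ->
  (forall k, s k 0%N = 1) ->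
  (forall k j, (0 < k)%N -> p k * s k j.+1 = p k + y * s k.+1 j) ->
  (forall k, (0 < k)%N -> a k.+1 = p k * y) ->
  (forall k, (0 < k)%N -> b k = p k + y) ->
  forall j k, (0 < k)%N ->
    b k - cfrac_tail a b k.+1 j = p k * s k j.+1 / s k.+1 j.
Proof.
move=> p0 s0 s1 sS aE bE; elim=> [|j IHj] k k_gt0.
  by rewrite /= subr0 sS // !s1 mulr1 divr1 bE.
rewrite [cfrac_tail _ _ _ _]/= IHj // aE // bE // [in RHS](sS k) //.
rewrite invf_div -mulrA.
(* The recurrence at level k+1 removes the sum of level k+2. *)
have -> : y * (s k.+2 j / (p k.+1 * s k.+1 j.+1)) = 1 - (s k.+1 j.+1)^-1.
  have -> : y * (s k.+2 j / (p k.+1 * s k.+1 j.+1)) =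
            (p k.+1 * s k.+1 j.+1 - p k.+1) / (p k.+1 * s k.+1 j.+1).
    by rewrite sS // addrAC subrr add0r mulrA.
  rewrite mulrBl divff ?mulf_neq0 ?p0 //; congr (_ - _).
  by rewrite invfM mulrA divff ?p0 // mul1r.
by rewrite mulrBr mulr1 opprB addrC addrA subrK mulrDl mulfK.
Qed.

(** The first partial numerator [y] lacks the factor [p 0] that the pattern of
    the others would give it. So the outermost quotient is [1 - (s 1 j)^-1]
    with no factor in front, and subtracting it from 1 leaves the reciprocal
    alone. *)
Lemma euler_cfrac (F : fieldType) (p a b : nat -> F) (y : F)
    (s : nat -> nat -> F) :
  (forall k, (0 < k)%N -> p k != 0) ->
  (forall k j, s k j != 0) ->
  (forall k, s k 0%N = 1) ->
  (forall k j, (0 < k)%N -> p k * s k j.+1 = p k + y * s k.+1 j) ->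
  a 1%N = y ->
  (forall k, (0 < k)%N -> a k.+1 = p k * y) ->
  (forall k, (0 < k)%N -> b k = p k + y) ->
  forall j, 1 - cfrac_tail a b 1 j = (s 1%N j)^-1.
Proof.
move=> p0 s0 s1 sS a1 aE bE [|j]; first by rewrite /= subr0 s1 invr1.
rewrite [cfrac_tail _ _ _ _]/= a1.
rewrite (@euler_cfrac_denominator _ p _ _ y s) // invf_div mulrA.
have -> : y * s 2%N j = p 1%N * s 1%N j.+1 - p 1%N.
  by rewrite sS // addrAC subrr add0r.
rewrite mulrBl divff ?mulf_neq0 ?p0 // subKr.
by rewrite invfM mulrA divff ?p0 // mul1r.
Qed.

(** * Partial sums as polynomials *)

(** The truncation below degree [2j+2] rather than [2j+1] only adds a zero
    coefficient, and makes the shift by ['X^2] uniform. *)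
Definition euler_sum {K : fieldType} (p : nat -> K) (k j : nat) : {poly K} :=
  \poly_(i < (2 * j).+2)
    (if odd i then 0 else (\prod_(k <= m < k + i./2) p m)^-1).

Lemma euler_sum_coef0 (K : fieldType) (p : nat -> K) k j :
  (euler_sum p k j)`_0 = 1.
Proof. by rewrite coef_poly /= addn0 big_geq // invr1. Qed.

Lemma euler_sum_neq0 (K : fieldType) (p : nat -> K) k j : euler_sum p k j != 0.
Proof.
by apply/eqP => /polyP /(_ 0%N) /eqP; rewrite euler_sum_coef0 coef0 oner_eq0.
Qed.

Lemma euler_sum0 (K : fieldType) (p : nat -> K) k : euler_sum p k 0 = 1.
Proof.
apply/polyP => -[|[|i]]; rewrite ?euler_sum_coef0 ?coef_poly ?coef1 //.
Qed.

Lemma euler_sumS (K : fieldType) (p : nat -> K) k j : p k != 0 ->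
  (p k)%:P * euler_sum p k j.+1 = (p k)%:P + 'X^2 * euler_sum p k.+1 j.
Proof.
move=> pk0; apply/polyP => i.
rewrite coefCM coefD coefC coefXnM; case: i => [|[|i]].
- by rewrite euler_sum_coef0 mulr1 addr0.
- by rewrite coef_poly mulr0 addr0.
rewrite /= add0r !subSS subn0 !coef_poly mulnS !ltnS /= negbK.
case: ifP => _; last by rewrite mulr0.
case: ifP => _; first by rewrite mulr0.
rewrite addnS big_ltn ?ltnS ?leq_addr // invfM mulrA divff // mul1r.
by rewrite addSn.
Qed.

(** * Inversion is x-adically continuous *)

(** The difference of the inverses is a multiple of [g - f], hence divisible by
    the same power of the variable. *)
Lemma fps_inv_agree (K : fieldType) (f g : fps K) n :
  f \is a GRing.unit -> g \is a GRing.unit ->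
  (forall i, (i < n)%N -> f i = g i) ->
  forall i, (i < n)%N -> f^-1 i = g^-1 i.
Proof.
move=> uf ug fg i lt_in; apply/eqP; rewrite -subr_eq0.
rewrite (_ : f^-1 i - g^-1 i = (f^-1 - g^-1) i) //.
have -> : f^-1 - g^-1 = (g - f) * (f^-1 * g^-1).
  by rewrite mulrBl mulrCA divrr // mulr1 mulrA divrr // mul1r.
rewrite /GRing.mul /= big1 // => -[m /= lt_mi] _.
by rewrite fg ?subrr ?mul0r // (leq_trans lt_mi).
Qed.

(** * The q-hypergeometric series *)

Lemma qnat_neq0 (K : fieldType) (q : K) n :
  (forall n, (0 < n)%N -> ~~ n.-unity_root q) -> (0 < n)%N -> qnat q n != 0.
Proof.
move=> hq n_gt0.
have q1 m : (0 < m)%N -> 1 - q ^+ m != 0.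
  by move=> /hq; rewrite unity_rootE subr_eq0 eq_sym.
by rewrite mulf_neq0 ?invr_eq0 ?q1 // -[q]expr1 q1.
Qed.

Lemma qpair_neq0 (K : fieldType) (q : K) N k :
  (forall n, (0 < n)%N -> ~~ n.-unity_root q) -> (0 < k)%N ->
  qpair q N k != 0.
Proof.
move=> hq; case: k => // k _.
by rewrite mulf_neq0 // qnat_neq0 // mulnS addnCA ?subn1.
Qed.

Lemma qfact_neq0 (K : fieldType) (q : K) n :
  (forall n, (0 < n)%N -> ~~ n.-unity_root q) -> qfact q n != 0.
Proof.
move=> hq; rewrite prodf_seq_neq0; apply/allP => i.
by rewrite mem_index_iota => /andP[i0 _]; exact: qnat_neq0.
Qed.

Lemma qfact_addl_double (K : fieldType) (q : K) N n :
  qfact q (2 * N + 2 * n)%N =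
  qfact q (2 * N)%N * \prod_(1 <= m < n.+1) qpair q N m.
Proof.
elim: n => [|n IHn]; first by rewrite muln0 addn0 big_geq // mulr1.
rewrite [in RHS]big_nat_recr //= mulrA -IHn /qfact /qpair mulnS addnCA add2n.
by rewrite 2?big_nat_recr //= mulrA subn1.
Qed.

Lemma qhyper_euler_sum (K : fieldType) (q : K) N j i :
  (forall n, (0 < n)%N -> ~~ n.-unity_root q) -> (i < (2 * j).+2)%N ->
  qhyper q N i = (euler_sum (qpair q N) 1 j)`_i.
Proof.
move=> hq lt_ij; rewrite coef_poly lt_ij /=; case: ifPn => // even_i.
rewrite -[in LHS](even_halfK even_i) -mul2n qfact_addl_double.
by rewrite invfM mulrA divff ?qfact_neq0 // mul1r.
Qed.

Lemma qEuler_cfracE (K : fieldType) (q : K) N j :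
  (forall n, (0 < n)%N -> ~~ n.-unity_root q) ->
  qEuler_cfrac q N j = (tofrac (euler_sum (qpair q N) 1 j))^-1.
Proof.
move=> hq.
apply: (@euler_cfrac _ (fun k => tofrac (qpair q N k)%:P) _ _ (tofrac 'X^2)
  (fun k j => tofrac (euler_sum (qpair q N) k j)))
  => [k k_gt0|k i|k|k i k_gt0||k k_gt0|k _].
- by rewrite tofrac_eq0 polyC_eq0 qpair_neq0.
- by rewrite tofrac_eq0 euler_sum_neq0.
- by rewrite euler_sum0 rmorph1.
- by rewrite -!rmorphM -rmorphD /= euler_sumS // qpair_neq0.
- by rewrite /qEuler_num eqxx scale1r.
- by rewrite /qEuler_num eqSS gtn_eqF //= -mul_polyC rmorphM.
- by rewrite /qEuler_den rmorphD.
Qed.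

Theorem theorem7 (R : realType) (q : R[i]) (N : nat)
    (hq1 : q != 1)
    (hq : forall n : nat, (0 < n)%N -> ~~ n.-unity_root q) :
  exists t : nat -> fps R[i],
    (forall j : nat, (0 < j)%N -> is_expansion (qEuler_cfrac q N j) (t j)) /\
    xadic_cvg t (egf (qEuler q N)).
Proof.
pose S j := euler_sum (qpair q N) 1 j.
exists (fun j => (fps_of_poly (S j))^-1); split=> [j _|n].
  exists 1, (S j); split.
  - by rewrite euler_sum_coef0 oner_neq0.
  - by rewrite qEuler_cfracE // rmorph1 mul1r.
  - rewrite (_ : fps_of_poly 1 = 1) ?mul1r //.
    by apply/fpsP => i; rewrite /= coef1.
rewrite egf_qEuler; last exact: Num.Theory.pchar_num.
exists n => j le_nj i lt_in.
apply: (@fps_inv_agree _ _ _ (2 * j).+2) => [||m lt_m|].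
- by rewrite fps_unitE /= euler_sum_coef0 oner_neq0.
- exact: qhyper_unit.
- by rewrite (qhyper_euler_sum _ _ _ j).
- apply: leq_trans lt_in (leq_trans le_nj _).
  by do 2!apply: leqW; rewrite leq_pmull.
Qed.
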